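(* The following equality holds: \[ \sum_{k\geq 0} g_k(\bullet;x,q)z^k=\frac{1}{1-q\sum_{k\geq 2}[k-1]_q\,e_kz^k }=\omega(F_2(x;q,z)), \] where $F_2(x;q,z)=\dfrac{1}{1-\sum_{n\ge2}q[n-1]_qh_nz^n}$.
   Context: $[n]=\{1,\dots,n\}$. A Hessenberg function is a non-decreasing $\mathbf m\colon[n]\to[n]$ with $\mathbf m(i)\ge i$ for all $i$. $h_j,e_j$ are the complete homogeneous and elementary symmetric functions ($h_0=e_0=1$), and $\omega$ is the involution, linear over $q$ and $z$, with $\omega(h_j)=e_j$. With $[n]_q=1+q+\dots+q^{n-1}$, $\rho_n$ ($n\ge1$) is defined recursively by $[n]_qh_n=\sum_{i=0}^{n-1}h_i\rho_{n-i}$. $S_{n,\mathbf m}=\{\sigma\in S_n:\sigma(i)\le\mathbf m(i)\text{ for all }i\}$. Each $\sigma\in S_n$ is written as its cycle decomposition $\sigma=\tau_1\cdots\tau_j$ (fixed points included), each cycle beginning with its smallest element and cycles ordered increasingly by their smallest elements; $|\tau_i|$ is the length of $\tau_i$. $\sigma^c$ is the permutation whose one-line notation is obtained by erasing the parentheses. $\mathrm{wt}_{\mathbf m}(\sigma)$ is the number of pairs $(i,j)$ with $i<j\le\mathbf m(i)$ and $(\sigma^c)^{-1}(i)>(\sigma^c)^{-1}(j)$. For $k<n$, \[ g_k(\mathbf m;x,q):=\sum_{\substack{\sigma=\tau_1\cdots \tau_{j}\in S_{n,\mathbf m}\\ |\tau_1|\geq n-k}} (-1)^{|\tau_1|-n+k}q^{\mathrm{wt}_{\mathbf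 m}(\sigma)}h_{|\tau_1|-n+k}\,\omega(\rho_{|\tau_2|}\cdots \rho_{|\tau_j|}). \] The path graph $P_n$ corresponds to $\mathbf m(i)=\min(i+1,n)$, and $g_k(P_n;x,q)$ denotes $g_k$ of this Hessenberg function. $\bullet$ is the graph with a single vertex, and for every $k\ge0$ one defines $g_k(\bullet;x,q):=g_k(P_N;x,q)$ for any $N>k$ (the value does not depend on $N$). *)

(* Defs.v *)
From HB Require Import structures.
From mathcomp Require Import all_boot all_order all_algebra all_fingroup.
From mathcomp Require Import boolp.
From mathcomp Require Import ssrcomplements freeg mpoly.

Set Implicit Arguments.
Unset Strict Implicit.
Unset Printing Implicit Defensive.

Import GRing.Theory.

Local Open Scope ring_scope.

#[local] Obligation Tactic := idtac.

(* The ring of symmetric functions over [R] is the inverse limit, in the category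
   of graded rings, of the rings of symmetric polynomials in [n] variables, along
   the maps that set the last variable to [0].  An element is a compatible family
   of symmetric polynomials of bounded degree. *)

Section Restriction.
Variable R : comNzRingType.

Definition mrestr n (p : {mpoly R[n.+1]}) : {mpoly R[n]} :=
  p \mPo [tuple oapp (fun j : 'I_n => 'X_j) 0 (unlift ord_max i) | i < n.+1].

Lemma mrestrD n : {morph @mrestr n : p q / p + q}.
Proof. exact: comp_mpolyD. Qed.

Lemma mrestrN n : {morph @mrestr n : p / - p}.
Proof. exact: comp_mpolyN. Qed.

Lemma mrestrM n : {morph @mrestr n : p q / p * q}.
Proof. by move=> p q; rewrite /mrestr rmorphM. Qed.

Lemma mrestrZ n c (p : {mpoly R[n.+1]}) : mrestr (c *: p) = c *: mrestr p.
Proof. exact: comp_mpolyZ. Qed.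

Lemma mrestrC n c : mrestr c%:MP_[n.+1] = c%:MP.
Proof. exact: comp_mpolyC. Qed.

Lemma mrestrX n (m : 'X_{1..n.+1}) :
  mrestr 'X_[m] =
  if m ord_max == 0%N then 'X_[[multinom m (fintype.lift ord_max i) | i < n]] else 0.
Proof.
rewrite /mrestr comp_mpolyX big_ord_recr /= tnth_mktuple unlift_none /= expr0n.
have -> : \prod_(i < n) tnth [tuple oapp (fun j : 'I_n => 'X_j) 0
    (unlift ord_max i0) | i0 < n.+1] (widen_ord (leqnSn n) i)
      ^+ m (widen_ord (leqnSn n) i) =
   'X_[[multinom m (fintype.lift ord_max i) | i < n]] :> {mpoly R[n]}.
  rewrite [RHS](mpolyXE _ 1); apply: eq_bigr => i _.
  have -> : widen_ord (leqnSn n) i = fintype.lift ord_max i.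
    by apply: val_inj; rewrite /= /bump leqNgt ltn_ord.
  by rewrite tnth_mktuple liftK perm1 /= mnmE.
by case: eqP; rewrite ?mulr1 ?mulr0.
Qed.

Lemma mcoeff_mrestr n (p : {mpoly R[n.+1]}) m :
  (mrestr p)@_m = p@_(mnmwiden m).
Proof.
rewrite [in LHS](mpolyE p) /mrestr (raddf_sum (@comp_mpoly _ R _ _)) raddf_sum /=.
rewrite [in RHS](mpolyE p) raddf_sum /=; apply: eq_bigr => k _.
rewrite comp_mpolyZ !mcoeffZ -/(mrestr _) mrestrX mcoeffX; congr (_ * _).
have lw (i : 'I_n) : fintype.lift ord_max i = widen_ord (leqnSn n) i.
  by apply: val_inj; rewrite /= /bump leqNgt ltn_ord.
case: eqP => k0.
  rewrite mcoeffX; congr (_%:R); congr nat_of_bool; apply/eqP/eqP.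
    move=> /mnmP e; apply/mnmP => i; case: (unliftP ord_max i) => [j|] ->.
      by rewrite [in RHS]lw mnmwiden_widen -e mnmE.
    by rewrite mnmwiden_ordmax.
  by move=> ->; apply/mnmP => i; rewrite mnmE lw mnmwiden_widen.
rewrite mcoeff0; case: eqP => // e; case: k0.
by rewrite e mnmwiden_ordmax.
Qed.

End Restriction.

Record symfun (R : comNzRingType) := SymFun {
  sfval :> forall n, {mpoly R[n]};
  sf_sym : forall n, sfval n \is symmetric;
  sf_restr : forall n, mrestr (sfval n.+1) = sfval n;
  sf_bdd : exists d, forall n, (msize (sfval n) <= d)%N
}.

Section SymFunRing.
Variable R : comNzRingType.
Implicit Types f g : symfun R.

Lemma symfunP f g : (forall n, f n = g n) -> f = g.
Proof.
case: f g => [f f1 f2 f3] [g g1 g2 g3] /= e.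
have fg : f = g by apply: functional_extensionality_dep.
by subst g; congr SymFun; apply: Prop_irrelevance.
Qed.

HB.instance Definition _ := gen_eqMixin (symfun R).
HB.instance Definition _ := gen_choiceMixin (symfun R).

Program Definition sf_const (c : R) : symfun R :=
  @SymFun R (fun n => c%:MP) _ _ _.
Next Obligation.
by move=> c n /=; rewrite -[c%:MP]mulr1 mul_mpolyC rpredZ ?rpred1.
Qed.
Next Obligation. by move=> c n /=; rewrite mrestrC. Qed.
Next Obligation. by move=> c; exists 1%N => n /=; rewrite msizeC leq_b1. Qed.

Program Definition sf_add f g : symfun R :=
  @SymFun R (fun n => f n + g n) _ _ _.
Next Obligation. by move=> f g n /=; rewrite rpredD ?sf_sym. Qed.
Next Obligation. by move=> f g n /=; rewrite mrestrD !sf_restr. Qed.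
Next Obligation.
move=> f g; have [[a fa] [b gb]] := (sf_bdd f, sf_bdd g).
exists (maxn a b) => n /=; apply: leq_trans (msizeD_le _ _) _.
by rewrite geq_max !leq_max fa gb orbT.
Qed.

Program Definition sf_opp f : symfun R :=
  @SymFun R (fun n => - f n) _ _ _.
Next Obligation. by move=> f n /=; rewrite rpredN ?sf_sym. Qed.
Next Obligation. by move=> f n /=; rewrite mrestrN !sf_restr. Qed.
Next Obligation.
by move=> f; have [a fa] := sf_bdd f; exists a => n /=; rewrite msizeN.
Qed.

Program Definition sf_mul f g : symfun R :=
  @SymFun R (fun n => f n * g n) _ _ _.
Next Obligation. by move=> f g n /=; rewrite rpredM ?sf_sym. Qed.
Next Obligation. by move=> f g n /=; rewrite mrestrM !sf_restr. Qed.
Next Obligation.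
move=> f g; have [[a fa] [b gb]] := (sf_bdd f, sf_bdd g).
exists (a + b).+1%N => n /=; apply: leq_trans (msizeM_le _ _) _.
by rewrite ltnS leq_add.
Qed.

Program Definition sf_scale c f : symfun R :=
  @SymFun R (fun n => c *: f n) _ _ _.
Next Obligation. by move=> c f n /=; rewrite rpredZ ?sf_sym. Qed.
Next Obligation. by move=> c f n /=; rewrite mrestrZ !sf_restr. Qed.
Next Obligation.
move=> c f; have [a fa] := sf_bdd f.
by exists a => n /=; apply: leq_trans (msizeZ_le _ _) _.
Qed.

Let sf0 := sf_const 0.
Let sf1 := sf_const 1.

Lemma sf_addA : associative sf_add.
Proof. by move=> f g k; apply: symfunP => n /=; rewrite addrA. Qed.
Lemma sf_addC : commutative sf_add.
Proof. by move=> f g; apply: symfunP => n /=; rewrite addrC. Qed.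
Lemma sf_add0 : left_id sf0 sf_add.
Proof. by move=> f; apply: symfunP => n /=; rewrite mpolyC0 add0r. Qed.
Lemma sf_addN : left_inverse sf0 sf_opp sf_add.
Proof. by move=> f; apply: symfunP => n /=; rewrite addNr mpolyC0. Qed.

HB.instance Definition _ :=
  GRing.isZmodule.Build (symfun R) sf_addA sf_addC sf_add0 sf_addN.

Lemma sf_mulA : associative sf_mul.
Proof. by move=> f g k; apply: symfunP => n /=; rewrite mulrA. Qed.
Lemma sf_mulC : commutative sf_mul.
Proof. by move=> f g; apply: symfunP => n /=; rewrite mulrC. Qed.
Lemma sf_mul1 : left_id sf1 sf_mul.
Proof. by move=> f; apply: symfunP => n /=; rewrite mpolyC1 mul1r. Qed.
Lemma sf_mulD : left_distributive sf_mul (@GRing.add (symfun R)).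
Proof. by move=> f g k; apply: symfunP => n /=; rewrite mulrDl. Qed.
Lemma sf_1neq0 : sf1 != (0 : symfun R).
Proof.
apply/eqP => /(congr1 (fun f : symfun R => f 0%N)) /= /eqP.
by rewrite mpolyC0 mpolyC1 oner_eq0.
Qed.

HB.instance Definition _ :=
  GRing.Zmodule_isComNzRing.Build (symfun R)
    sf_mulA sf_mulC sf_mul1 sf_mulD sf_1neq0.

Lemma sf_scaleA a b f : sf_scale a (sf_scale b f) = sf_scale (a * b) f.
Proof. by apply: symfunP => n /=; rewrite scalerA. Qed.
Lemma sf_scale1 : left_id 1 sf_scale.
Proof. by move=> f; apply: symfunP => n /=; rewrite scale1r. Qed.
Lemma sf_scaleDr : right_distributive sf_scale +%R.
Proof. by move=> c f g; apply: symfunP => n /=; rewrite scalerDr. Qed.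
Lemma sf_scaleDl f : {morph sf_scale^~ f : a b / a + b}.
Proof. by move=> a b; apply: symfunP => n /=; rewrite scalerDl. Qed.

HB.instance Definition _ :=
  GRing.Zmodule_isLmodule.Build R (symfun R)
    sf_scaleA sf_scale1 sf_scaleDr sf_scaleDl.

Lemma sf_scaleAl c f g : c *: (f * g) = c *: f * g.
Proof. by apply: symfunP => n /=; rewrite scalerAl. Qed.

HB.instance Definition _ :=
  GRing.Lmodule_isLalgebra.Build R (symfun R) sf_scaleAl.

Lemma sf_scaleAr c f g : c *: (f * g) = f * (c *: g).
Proof. by apply: symfunP => n /=; rewrite scalerAr. Qed.

HB.instance Definition _ :=
  GRing.Lalgebra_isAlgebra.Build R (symfun R) sf_scaleAr.

End SymFunRing.

Section CompleteElementary.
Variable R : comNzRingType.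

Definition mcomplete n k : {mpoly R[n]} :=
  \sum_(m : 'X_{1..n < k.+1} | mdeg m == k) 'X_[m].

Lemma mcoeff_mcomplete n k m : (mcomplete n k)@_m = (mdeg m == k)%:R.
Proof.
rewrite /mcomplete raddf_sum /=; have [mk|mk] := eqVneq (mdeg m) k.
  have mlt : (mdeg m < k.+1)%N by rewrite mk.
  rewrite (bigD1 (BMultinom mlt)) /= ?mk // mcoeffX eqxx big1 ?addr0 // => i.
  move=> /andP[_ ne]; rewrite mcoeffX; case: eqP => // e.
  by case/eqP: ne; apply: val_inj.
rewrite big1 // => i /eqP ik; rewrite mcoeffX; case: eqP => // e.
by case/eqP: mk; rewrite -e.
Qed.

Lemma mdeg_mnmwiden n (m : 'X_{1..n}) : mdeg (mnmwiden m) = mdeg m.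
Proof.
rewrite !mdegE big_ord_recr /= mnmwiden_ordmax addn0.
by apply: eq_bigr => i _; rewrite mnmwiden_widen.
Qed.

Lemma msize_dhomog n d (p : {mpoly R[n]}) :
  p \is d.-homog -> (msize p <= d.+1)%N.
Proof.
by move=> /dhomogP hp; rewrite msizeE; apply/bigmax_leqP_seq => m /hp -> _.
Qed.

Program Definition sfh k : symfun R := @SymFun R (fun n => mcomplete n k) _ _ _.
Next Obligation.
move=> k n /=; apply/issymP => s; apply/mpolyP => m.
by rewrite mcoeff_sym !mcoeff_mcomplete mdeg_mperm.
Qed.
Next Obligation.
move=> k n /=; apply/mpolyP => m.
by rewrite mcoeff_mrestr !mcoeff_mcomplete mdeg_mnmwiden.
Qed.
Next Obligation.
move=> k; exists k.+1 => n /=; apply: msize_dhomog; apply/dhomogP => m.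
by rewrite mcoeff_msupp mcoeff_mcomplete; case: (mdeg m =P k) => //; rewrite eqxx.
Qed.

Program Definition sfe k : symfun R := @SymFun R (fun n => mesym n R k) _ _ _.
Next Obligation. by move=> k n; apply: mesym_sym. Qed.
Next Obligation.
move=> k n /=; apply/mpolyP => m.
rewrite mcoeff_mrestr !mcoeff_mesym /mechar mdeg_mnmwiden.
congr (_ && _)%:R; apply/forallP/forallP => /= H i.
  by have := H (widen_ord (leqnSn n) i); rewrite mnmwiden_widen.
case: (unliftP ord_max i) => [j|] ->; last by rewrite mnmwiden_ordmax.
have -> : fintype.lift ord_max j = widen_ord (leqnSn n) j.
  by apply: val_inj; rewrite /= /bump leqNgt ltn_ord.
by rewrite mnmwiden_widen.
Qed.
Next Obligation.
by move=> k; exists k.+1 => n /=; apply/msize_dhomog/dhomog_mesym.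
Qed.

Lemma sfh0 : sfh 0 = 1.
Proof.
apply: symfunP => n /=; apply/mpolyP => m.
by rewrite mcoeff_mcomplete mcoeffC mul1r mdeg_eq0.
Qed.

Lemma sfe0 : sfe 0 = 1.
Proof. by apply: symfunP => n /=; rewrite mesym0E. Qed.

Lemma sfD_val (f g : symfun R) n : (f + g) n = f n + g n. Proof. by []. Qed.
Lemma sfB_val (f g : symfun R) n : (f - g) n = f n - g n. Proof. by []. Qed.
Lemma sfM_val (f g : symfun R) n : (f * g) n = f n * g n. Proof. by []. Qed.
Lemma sfZ_val c (f : symfun R) n : (c *: f) n = c *: f n. Proof. by []. Qed.
Lemma sf0_val n : (0 : symfun R) n = 0.
Proof. exact: mpolyC0. Qed.
Lemma sf1_val n : (1 : symfun R) n = 1.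
Proof. exact: mpolyC1. Qed.
Lemma sf_sum_val I (r : seq I) (P : pred I) (F : I -> symfun R) n :
  (\sum_(i <- r | P i) F i) n = \sum_(i <- r | P i) F i n.
Proof.
exact: (big_morph (fun f : symfun R => f n) (fun f g => sfD_val f g n) (sf0_val n)).
Qed.
Lemma sf_prod_val I (r : seq I) (P : pred I) (F : I -> symfun R) n :
  (\prod_(i <- r | P i) F i) n = \prod_(i <- r | P i) F i n.
Proof.
exact: (big_morph (fun f : symfun R => f n) (fun f g => sfM_val f g n) (sf1_val n)).
Qed.
Lemma sfX_val (f : symfun R) k n : (f ^+ k) n = f n ^+ k.
Proof. by elim: k => [|k IH]; rewrite ?expr0 ?sf1_val // !exprS sfM_val IH. Qed.

Lemma mcoeffM_X n (p : {mpoly R[n]}) m k :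
  (p * 'X_[m])@_k = if (m <= k)%MM then p@_(k - m) else 0.
Proof.
case: ifP => mk.
  by rewrite -{1}(submK mk) addmC mcoeffMX.
rewrite (mpolyE p) mulr_suml raddf_sum /= big1 // => j _.
rewrite -scalerAl -mpolyXD mcoeffZ mcoeffX; case: eqP => [e|]; last by rewrite mulr0.
move/negP: mk; case; rewrite -e; apply/mnm_lepP => i.
by rewrite mnmDE leq_addl.
Qed.

Lemma sum_sfe_sfh n : (0 < n)%N ->
  \sum_(i < n.+1) (-1) ^+ i *: (sfe i * sfh (n - i)) = 0.
Proof.
move=> n0; apply: symfunP => N; rewrite sf0_val sf_sum_val; apply/mpolyP => m.
rewrite mcoeff0 raddf_sum /=.
pose F (S : {set 'I_N}) : R :=
  if (mesym1 S <= m)%MM then (-1) ^+ #|S| * (mdeg m == n)%:R else 0.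
transitivity (\sum_(i < n.+1) \sum_(S : {set 'I_N} | #|S| == i) F S).
  apply: eq_bigr => i _.
  rewrite mcoeffZ mesymE mulr_suml raddf_sum /= mulr_sumr.
  apply: eq_bigr => S /eqP Si.
  rewrite mulrC [X in X@_m]mulrC mcoeffM_X /F Si.
  case: ifP => Sm; rewrite ?mul0r // mcoeff_mcomplete mulrC.
  have := congr1 mdeg (submK Sm); rewrite mdegD mdeg_mesym1 Si => <-.
  by congr (_ * (nat_of_bool _)%:R); rewrite -(eqn_add2r i) subnK // leq_ord.
transitivity (\sum_(S : {set 'I_N}) F S).
  rewrite (partition_big (fun S : {set 'I_N} => inord #|S| : 'I_n.+1) xpredT) //=.
  apply: eq_bigr => i _; apply/esym.
  rewrite (bigID (fun S : {set 'I_N} => #|S| == i)) /= [X in _ + X]big1 ?addr0.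
    apply: eq_bigl => S; apply/andP/idP => [[]//|/eqP Si]; split; last exact/eqP.
    by rewrite Si inord_val.
  move=> S /andP[/eqP Si /eqP nSi]; rewrite /F; case: ifP => // Sm.
  case: eqP => mn; last by rewrite mulr0.
  case: nSi; rewrite -Si inordK // ltnS -mn -(submK Sm) mdegD mdeg_mesym1.
  exact: leq_addl.
rewrite /F; case: (mdeg m =P n) => mn; last first.
  by apply: big1 => S _; case: ifP; rewrite ?mulr0.
have [a ma] : exists a, (0 < m a)%N.
  apply/existsP; apply: contraLR n0; rewrite negb_exists => /forallP H.
  rewrite -mn mdegE big1 // => i _; apply/eqP; move: (H i).
  by rewrite -leqNgt leqn0.
transitivity (\prod_(i < N) ((if (0 < m i)%N then -1 else 0) + 1 : R)); last first.
  by rewrite (bigD1 a) //= ma addNr mul0r.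
rewrite bigA_distr; apply: eq_bigr => S _.
rewrite [RHS](bigID (mem S)) /= [X in _ = _ * X]big1 ?mulr1; last first.
  by move=> i /negbTE ->.
case: ifP => [/mnm_lepP Sm|/negbT].
  rewrite -prodr_const; apply: eq_bigr => i iS.
  by have := Sm i; rewrite mnmE iS => ->.
rewrite negb_forall => /existsP[i]; rewrite mnmE -ltnNge => Hi.
have [iS mi] : i \in S /\ m i = 0%N by case: (i \in S) Hi => //; case: (m i).
by rewrite (bigD1 i) //= iS mi ltnn mul0r.
Qed.

End CompleteElementary.

Section Omega.
Variable R : comNzRingType.
Notation Lam := (symfun R).
Implicit Types (f g : Lam) (v : nat -> Lam).

(* [sfev v t] is [t(v_1, ..., v_N)]. *)
Definition sfev v N (t : {mpoly R[N]}) : Lam :=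
  mmap (in_alg Lam) (fun i : 'I_N => v i.+1) t.

Lemma sfevD v N : {morph @sfev v N : t u / t + u}.
Proof. exact: mmapD. Qed.
Lemma sfevB v N : {morph @sfev v N : t u / t - u}.
Proof. exact: mmapB. Qed.
Lemma sfevM v N : {morph @sfev v N : t u / t * u}.
Proof. by move=> t u; rewrite /sfev rmorphM. Qed.
Lemma sfevC v N c : sfev v c%:MP_[N] = c%:A.
Proof. exact: mmapC. Qed.
Lemma sfevZ v N c t : @sfev v N (c *: t) = c *: sfev v t.
Proof. by rewrite /sfev mmapZ /= mulr_algl. Qed.
Lemma sfevXU v N (i : 'I_N) : sfev v 'X_i = v i.+1.
Proof. by rewrite /sfev mmapX mmap1U. Qed.
Lemma sfevXm v N m : @sfev v N 'X_[m] = \prod_(i < N) v i.+1 ^+ m i.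
Proof. by rewrite /sfev mmapX. Qed.
Lemma sfev_sum v N I (r : seq I) (P : pred I) F :
  @sfev v N (\sum_(i <- r | P i) F i) = \sum_(i <- r | P i) sfev v (F i).
Proof.
by apply: (big_morph (@sfev v N) (@sfevD v N)); rewrite -mpolyC0 sfevC scale0r.
Qed.

Lemma sfevE v N t :
  @sfev v N t = \sum_(m <- msupp t) t@_m *: \prod_(i < N) v i.+1 ^+ m i.
Proof.
by rewrite {1}(mpolyE t) sfev_sum; apply: eq_bigr => m _; rewrite sfevZ sfevXm.
Qed.

Lemma sfev_val v N t n :
  @sfev v N t n = t \mPo [tuple v i.+1 n | i < N].
Proof.
rewrite sfevE sf_sum_val comp_mpolyE; apply: eq_bigr => m _.
rewrite sfZ_val sf_prod_val; congr (_ *: _); apply: eq_bigr => i _.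
by rewrite sfX_val tnth_mktuple.
Qed.

Definition mwide N M (le : (N <= M)%N) (t : {mpoly R[N]}) : {mpoly R[M]} :=
  t \mPo [tuple 'X_(widen_ord le i) | i < N].

Lemma sfev_wide v N M (le : (N <= M)%N) t : sfev v (mwide le t) = sfev v t.
Proof.
rewrite /mwide comp_mpolyE sfev_sum sfevE; apply: eq_bigr => m _.
rewrite sfevZ; congr (_ *: _).
elim/big_rec2: _ => [|i y x _ <-]; first by rewrite -mpolyC1 sfevC scale1r.
rewrite sfevM; congr (_ * _); rewrite tnth_mktuple.
elim: (m i) => [|k IH]; first by rewrite !expr0 -mpolyC1 sfevC scale1r.
by rewrite !exprS sfevM IH sfevXU.
Qed.

Notation E := (sfe R).
Notation H := (sfh R).

Lemma sfev_inj N (t u : {mpoly R[N]}) : sfev E t = sfev E u -> t = u.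
Proof.
move=> /(congr1 (fun f : Lam => f N)); rewrite !sfev_val.
exact: msym_fundamental_un.
Qed.

Lemma sfev_wd N M (t : {mpoly R[N]}) (u : {mpoly R[M]}) v :
  sfev E t = sfev E u -> sfev v t = sfev v u.
Proof.
rewrite -(sfev_wide E (leq_maxl N M) t) -(sfev_wide E (leq_maxr N M) u).
by move/sfev_inj => e; rewrite -(sfev_wide v (leq_maxl N M)) e sfev_wide.
Qed.

Lemma sf_eq0 f d : (forall n, (msize (f n) <= d.+1)%N) -> f d = 0 -> f = 0.
Proof.
move=> fd f0; have up k : f (d + k)%N = 0.
  elim: k => [|k IH]; first by rewrite addn0.
  rewrite addnS; apply/mpolyP => m; rewrite mcoeff0.
  have [dm|md] := ltnP d (mdeg m).
    by apply/eqP; rewrite mcoeff_eq0 msize_mdeg_ge // (leq_trans (fd _)).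
  have [i mi] : exists i, m i = 0%N.
    apply: contrapT => no; have: (d + k < mdeg m)%N; last first.
      by rewrite ltnNge (leq_trans md) // leq_addr.
    rewrite mdegE -[X in (X <= _)%N]card_ord -sum1_card; apply: leq_sum => i _.
    by rewrite lt0n; apply/eqP => mi; case: no; exists i.
  have sy := sf_sym f (d + k).+1.
  rewrite -(msym_coeff m (tperm i ord_max) sy); set m' := (X in mcoeff X _).
  have m'0 : m' ord_max = 0%N by rewrite mnmE tpermR.
  have -> : m' = mnmwiden [multinom m' (widen_ord (leqnSn (d + k)) j) | j < d + k].
    apply/mnmP => j; case: (unliftP ord_max j) => [l|] ->.
      have -> : fintype.lift ord_max l = widen_ord (leqnSn (d + k)) l.
        by apply: val_inj; rewrite /= /bump leqNgt ltn_ord.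
      by rewrite mnmwiden_widen mnmE.
    by rewrite mnmwiden_ordmax.
  by rewrite -mcoeff_mrestr sf_restr IH mcoeff0.
apply: symfunP => n; rewrite sf0_val.
have [nd|/ltnW dn] := leqP d n; first by rewrite -(subnKC nd) up.
move: f0; rewrite -(subnKC dn); elim: (d - n)%N => [|k IH]; first by rewrite addn0.
rewrite addnS => e; apply: IH; rewrite -sf_restr e.
by rewrite -[0 in LHS]mpolyC0 mrestrC mpolyC0.
Qed.

Lemma msize_prod_sfe N (m : 'X_{1..N}) n :
  (msize ((\prod_(i < N) E i.+1 ^+ m i) n) <= (mnmwgt m).+1)%N.
Proof.
apply: msize_dhomog; rewrite sf_prod_val /mnmwgt.
elim/big_rec2: _ => [|i y x _ IH]; first exact: dhomog1.
apply: dhomogM IH; rewrite sfX_val mulnC; apply: dhomogMn.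
exact: dhomog_mesym.
Qed.

Lemma sfev_onto f d N : (forall n, (msize (f n) <= d)%N) -> (d <= N)%N ->
  exists t : {mpoly R[N]}, f = sfev E t.
Proof.
move=> fd dN; have [t [tf tw]] := sym_fundamental (sf_sym f N).
exists t; apply/eqP; rewrite -subr_eq0; apply/eqP; apply: (@sf_eq0 _ N).
  move=> n; rewrite sfB_val (leq_trans (msizeD_le _ _)) // geq_max msizeN.
  rewrite (leq_trans (fd n)) ?(leq_trans dN) //= sfevE sf_sum_val.
  apply: leq_trans (mmeasure_sum _ _ _ _) _; apply/bigmax_leqP_seq => m mt _.
  apply: leq_trans (mmeasureZ_le _ _ _) _.
  apply: leq_trans (msize_prod_sfe _ _) _; rewrite ltnS.
  have /ltnW mw : (mnmwgt m < mweight t)%N by apply: (@mmeasure_mnm_lt _ R (Measure.clone _ mnmwgt _) t m mt).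
  by rewrite (leq_trans mw) // (leq_trans tw) // (leq_trans (fd N)).
by rewrite sfB_val sfev_val -tf subrr.
Qed.

Lemma sfev_onto2 f g : exists N (t u : {mpoly R[N]}), f = sfev E t /\ g = sfev E u.
Proof.
have [[a fa] [b gb]] := (sf_bdd f, sf_bdd g).
have [t ft] := sfev_onto fa (leq_maxl a b).
have [u gu] := sfev_onto gb (leq_maxr a b).
by exists (maxn a b), t, u.
Qed.

Lemma sfev_onto1 f : exists N (t : {mpoly R[N]}), f = sfev E t.
Proof. by have [N [t [_ [? _]]]] := sfev_onto2 f f; exists N, t. Qed.

Definition omega_fun f : Lam :=
  let: exist N HN := cid (sfev_onto1 f) in sfev H (projT1 (cid HN)).

Lemma omega_funE N (t : {mpoly R[N]}) : omega_fun (sfev E t) = sfev H t.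
Proof.
rewrite /omega_fun; case: cid => M HM; case: cid => u /= e.
by apply: sfev_wd; rewrite -e.
Qed.

Lemma omega_fun_zmod_morphism : zmod_morphism omega_fun.
Proof.
move=> f g; have [N [t [u [-> ->]]]] := sfev_onto2 f g.
by rewrite -sfevB !omega_funE sfevB.
Qed.

Lemma omega_fun_monoid_morphism : monoid_morphism omega_fun.
Proof.
split=> [|f g].
  have e v : 1 = @sfev v 0 1%:MP by rewrite sfevC scale1r.
  by rewrite {1}(e E) omega_funE -e.
have [N [t [u [-> ->]]]] := sfev_onto2 f g.
by rewrite -sfevM !omega_funE sfevM.
Qed.

Lemma omega_fun_scalable : scalable omega_fun.
Proof.
move=> c f; have [N [t ->]] := sfev_onto1 f.
by rewrite -sfevZ !omega_funE sfevZ.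
Qed.

HB.instance Definition _ :=
  GRing.isZmodMorphism.Build Lam Lam omega_fun omega_fun_zmod_morphism.
HB.instance Definition _ :=
  GRing.isMonoidMorphism.Build Lam Lam omega_fun omega_fun_monoid_morphism.
HB.instance Definition _ :=
  GRing.isScalable.Build R Lam Lam *:%R omega_fun omega_fun_scalable.

Lemma omega_fun_e j : omega_fun (E j) = H j.
Proof.
case: j => [|j]; first by rewrite sfe0 sfh0 rmorph1.
have e v : v j.+1 = @sfev v j.+1 'X_ord_max by rewrite sfevXU.
by rewrite (e E) omega_funE -e.
Qed.

Lemma sum_sfh_sfe n : (0 < n)%N ->
  \sum_(i < n.+1) (-1) ^+ i *: (H i * E (n - i)) = 0.
Proof.
move=> n0; rewrite (reindex_inj rev_ord_inj) /=.
transitivity ((-1) ^+ n *: \sum_(i < n.+1) (-1) ^+ i *: (E i * H (n - i))).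
  rewrite scaler_sumr; apply: eq_bigr => i _.
  rewrite subSS scalerA -exprD mulrC subKn ?leq_ord //; congr (_ *: _).
  by rewrite -signr_odd oddB ?leq_ord // -oddD signr_odd.
by rewrite sum_sfe_sfh // scaler0.
Qed.

Lemma omega_hom_swap (w : {lrmorphism Lam -> Lam}) (A B : nat -> Lam) :
    A 0%N = 1 -> B 0%N = 1 ->
    (forall n, (0 < n)%N -> \sum_(i < n.+1) (-1) ^+ i *: (A i * B (n - i)%N) = 0) ->
    (forall n, (0 < n)%N -> \sum_(i < n.+1) (-1) ^+ i *: (B i * A (n - i)%N) = 0) ->
  (forall j, w (A j) = B j) -> forall j, w (B j) = A j.
Proof.
move=> A0 B0 AB BA wA; elim/ltn_ind => n IH.
case: n IH => [|n] IH; first by rewrite A0 B0 rmorph1.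
have e : w (\sum_(i < n.+2) (-1) ^+ i *: (A i * B (n.+1 - i)%N)) =
    \sum_(i < n.+2) (-1) ^+ i *: (B i * A (n.+1 - i)%N).
  by rewrite AB // BA // rmorph0.
move: e; rewrite raddf_sum /= !(big_ord_recl n.+1) /= !expr0 !scale1r !subn0 A0 B0 !mul1r.
set U := bigop _ _ _; set V := bigop _ _ _; have -> : U = V; last by move/addIr.
apply: eq_bigr => i _; rewrite linearZ /= rmorphM /= wA IH //.
by rewrite /bump /= add1n subSS ltnS leq_subr.
Qed.

Lemma omega_fun_h j : omega_fun (H j) = E j.
Proof.
apply: (@omega_hom_swap omega_fun E H); rewrite ?sfe0 ?sfh0 //.
- exact: sum_sfe_sfh.
- exact: sum_sfh_sfe.
- exact: omega_fun_e.
Qed.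

Lemma omega_exists :
  exists w : {lrmorphism Lam -> Lam}, forall j, w (H j) = E j.
Proof. by exists omega_fun; apply: omega_fun_h. Qed.

(* Unique by [omega_unique]. *)
Definition omega : {lrmorphism Lam -> Lam} := projT1 (cid omega_exists).

Lemma omega_h j : omega (H j) = E j.
Proof. exact: (projT2 (cid omega_exists)). Qed.

Lemma omega_e j : omega (E j) = H j.
Proof.
apply: (@omega_hom_swap omega H E); rewrite ?sfe0 ?sfh0 //.
- exact: sum_sfh_sfe.
- exact: sum_sfe_sfh.
- exact: omega_h.
Qed.

Lemma omega_unique (w : {lrmorphism Lam -> Lam}) :
  (forall j, w (H j) = E j) -> w =1 omega.
Proof.
move=> wH f; have wE : forall j, w (E j) = H j.
  apply: (@omega_hom_swap w H E); rewrite ?sfe0 ?sfh0 //.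
  - exact: sum_sfh_sfe.
  - exact: sum_sfe_sfh.
have [N [t ->]] := sfev_onto1 f; rewrite sfevE !raddf_sum /=.
apply: eq_bigr => m _; rewrite !linearZ /= !rmorph_prod /=; congr (_ *: _).
by apply: eq_bigr => i _; rewrite !rmorphXn /= wE omega_e.
Qed.

Lemma omegaK : involutive omega.
Proof.
move=> f; have [N [t ->]] := sfev_onto1 f; rewrite sfevE !raddf_sum /=.
apply: eq_bigr => m _; rewrite !linearZ /= !rmorph_prod /=; congr (_ *: _).
by apply: eq_bigr => i _; rewrite !rmorphXn /= omega_e omega_h.
Qed.

End Omega.

(* The set {1, ..., n} is modelled by ['I_n], so all indices are shifted down by
   one. *)

Section Cycles.
Variables (n : nat) (s : 'S_n).

(* [enum 'I_n] is increasing, so the cycles come ordered by their least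
   elements; [fingraph.orbit s x] is [:: x; s x; s (s x); ...]. *)
Definition cycle_decomp : seq (seq 'I_n) :=
  [seq fingraph.orbit s x |
    x <- enum 'I_n & [forall y in fingraph.orbit s x, (x <= y)%N]].

Lemma uniq_flatten_orbits (l : seq 'I_n) :
    uniq l -> {in l &, forall x y, x \in fingraph.orbit s y -> x = y} ->
  uniq (flatten [seq fingraph.orbit s x | x <- l]).
Proof.
have sy := fconnect_sym (@perm_inj _ s).
elim: l => //= x l IH /andP[xl ul] H; rewrite cat_uniq fingraph.orbit_uniq /= IH //.
  rewrite andbT; apply/hasPn => y /flattenP[_ /mapP[z zl ->]] yz.
  apply: contra xl => yx; suff -> : x = z by [].
  apply: H; rewrite ?mem_head ?inE ?zl ?orbT //.
  move: yz yx; rewrite -!fconnect_orbit => yz xy.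
  by apply: connect_trans yz _; rewrite sy.
by move=> y z yl zl; apply: H; rewrite inE ?yl ?zl orbT.
Qed.

Lemma mem_flatten_cycle_decomp y : y \in flatten cycle_decomp.
Proof.
have sy := fconnect_sym (@perm_inj _ s).
have [x xy xmin] := arg_minnP (fun x : 'I_n => x : nat) (in_orbit s y).
apply/flattenP; exists (fingraph.orbit s x); last first.
  by rewrite -fconnect_orbit sy fconnect_orbit.
apply: map_f; rewrite mem_filter mem_enum andbT; apply/forall_inP => z zx.
have yx : x \in fingraph.orbit s y := xy.
apply: xmin; change (is_true (z \in fingraph.orbit s y)).
by move: yx zx; rewrite -!fconnect_orbit; apply: connect_trans.
Qed.

Lemma uniq_flatten_cycle_decomp : uniq (flatten cycle_decomp).
Proof.
have sy := fconnect_sym (@perm_inj _ s).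
apply: uniq_flatten_orbits; first by rewrite filter_uniq ?enum_uniq.
move=> x y; rewrite !mem_filter => /andP[/forall_inP xm _] /andP[/forall_inP ym _].
move=> xy; apply: val_inj; apply/eqP; rewrite eqn_leq (ym _ xy) andbT.
by apply: xm; rewrite -fconnect_orbit sy fconnect_orbit.
Qed.

Lemma size_flatten_cycle_decomp : size (flatten cycle_decomp) = n.
Proof.
rewrite -[RHS](size_enum_ord n); apply/perm_size/uniq_perm.
- exact: uniq_flatten_cycle_decomp.
- exact: enum_uniq.
- by move=> y; rewrite mem_flatten_cycle_decomp mem_enum.
Qed.

Lemma erase_parens_inj : injective (fun i : 'I_n => nth i (flatten cycle_decomp) i).
Proof.
move=> i j; rewrite (set_nth_default i j) ?size_flatten_cycle_decomp // => /eqP.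
rewrite nth_uniq ?size_flatten_cycle_decomp ?uniq_flatten_cycle_decomp //.
by move/eqP/val_inj.
Qed.

(* The one-line notation of [erase_parens s] is [flatten (cycle_decomp s)]. *)
Definition erase_parens : 'S_n := perm erase_parens_inj.

End Cycles.

Record hessenberg n := Hessenberg {
  hess :> 'I_n -> 'I_n;
  hess_homo : forall i j : 'I_n, (i <= j)%N -> (hess i <= hess j)%N;
  hess_ge : forall i : 'I_n, (i <= hess i)%N
}.

Lemma path_hess_subproof n (i : 'I_n) : (minn i.+1 n.-1 < n)%N.
Proof. by case: n i => [[]//|n] i; rewrite ltnS geq_minr. Qed.

Program Definition path_hess n : hessenberg n :=
  @Hessenberg n (fun i => Ordinal (path_hess_subproof i)) _ _.
Next Obligation.
by move=> n i j ij /=; rewrite leq_min !geq_min ltnS ij leqnn orbT.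
Qed.
Next Obligation.
by case=> [[]//|n] i /=; rewrite leq_min leqnSn /= -ltnS ltn_ord.
Qed.

Definition hess_perms n (m : hessenberg n) : {set 'S_n} :=
  [set s : 'S_n | [forall i, (s i <= m i)%N]].

Definition hess_wt n (m : hessenberg n) (s : 'S_n) : nat :=
  #|[set p : 'I_n * 'I_n | (p.1 < p.2 <= m p.1)%N &&
      ((erase_parens s)^-1%g p.1 > (erase_parens s)^-1%g p.2)%N]|.

(* Symmetric functions are taken over [R[q]] with [R] an arbitrary commutative
   ring, so [q] is ['X : {poly R}]. *)

Section GFunctions.
Variable R : comNzRingType.
Notation Lam := (symfun {poly R}).

Definition qint n : {poly R} := \sum_(i < n) 'X^i.

(* [rho_seq n] is [:: 0; rho_1; ...; rho_n]; the value at index [0] is junk. The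
   defining recursion is [rhoE]. *)
Fixpoint rho_seq n : seq Lam :=
  if n is n'.+1 then
    rcons (rho_seq n')
      (qint n *: sfh _ n - \sum_(1 <= i < n) sfh _ i * (rho_seq n')`_(n - i))
  else [:: 0].

Definition rho n : Lam := (rho_seq n)`_n.

Lemma size_rho_seq n : size (rho_seq n) = n.+1.
Proof. by elim: n => //= n IH; rewrite size_rcons IH. Qed.

Lemma nth_rho_seq n i : (i <= n)%N -> (rho_seq n)`_i = rho i.
Proof.
elim: n => [|n IH]; first by rewrite leqn0 => /eqP ->.
rewrite leq_eqVlt => /predU1P[-> //|]; rewrite ltnS => lin /=.
by rewrite nth_rcons size_rho_seq ltnS lin IH.
Qed.

Lemma rhoE n : (0 < n)%N ->
  qint n *: sfh _ n = \sum_(0 <= i < n) sfh _ i * rho (n - i).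
Proof.
case: n => // n _; rewrite big_nat_recl // sfh0 mul1r subn0.
rewrite {1}/rho /= nth_rcons size_rho_seq ltnn eqxx big_add1 /=.
rewrite [X in _ = _ - X + _](_ : _ = \sum_(0 <= i < n) sfh _ i.+1 * rho (n.+1 - i.+1)).
  by rewrite subrK.
by apply: eq_bigr => i _; rewrite nth_rho_seq // subSS leq_subr.
Qed.

(* In [hess_g m k] one should have [k < n]; both truncated subtractions are
   then exact on the range of summation. *)
Definition hess_g n (m : hessenberg n) k : Lam :=
  \sum_(s in hess_perms m | (n - k <= size (head [::] (cycle_decomp s)))%N)
    let a := (size (head [::] (cycle_decomp s)) - (n - k))%N in
    ((-1) ^+ a * 'X ^+ hess_wt m s) *:
      (sfh _ a *
       omega _ (\prod_(c <- behead (cycle_decomp s)) rho (size c))).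

End GFunctions.

(* A formal power series in [z] is the sequence of its coefficients. *)

Section PowerSeries.
Variable A : comNzRingType.
Implicit Types a b : nat -> A.

Definition ps_one : nat -> A := fun n => (n == 0%N)%:R.

Definition ps_mul a b : nat -> A := fun n => \sum_(i < n.+1) a i * b (n - i)%N.

Fixpoint ps_inv_seq a n : seq A :=
  if n is n'.+1 then
    rcons (ps_inv_seq a n') (- \sum_(1 <= i < n.+1) a i * (ps_inv_seq a n')`_(n - i))
  else [:: 1].

(* The inverse of a power series with constant coefficient [1]. *)
Definition ps_inv a : nat -> A := fun n => (ps_inv_seq a n)`_n.

Lemma size_ps_inv_seq a n : size (ps_inv_seq a n) = n.+1.
Proof. by elim: n => //= n IH; rewrite size_rcons IH. Qed.

Lemma nth_ps_inv_seq a n i : (i <= n)%N -> (ps_inv_seq a n)`_i = ps_inv a i.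
Proof.
elim: n => [|n IH]; first by rewrite leqn0 => /eqP ->.
rewrite leq_eqVlt => /predU1P[-> //|]; rewrite ltnS => lin /=.
by rewrite nth_rcons size_ps_inv_seq ltnS lin IH.
Qed.

Lemma ps_mulV a : a 0%N = 1 -> ps_mul a (ps_inv a) =1 ps_one.
Proof.
move=> a0 [|n]; first by rewrite /ps_mul big_ord1 a0 mul1r.
rewrite /ps_mul -(big_mkord xpredT (fun i => a i * ps_inv a (n.+1 - i)%N)).
rewrite big_nat_recl // a0 mul1r subn0.
rewrite {1}/ps_inv /= nth_rcons size_ps_inv_seq ltnn eqxx big_add1 /=.
rewrite [X in - X + _](_ : _ = \sum_(0 <= i < n.+1) a i.+1 * ps_inv a (n.+1 - i.+1)%N).
  by rewrite addNr.
by apply: eq_bigr => i _; rewrite nth_ps_inv_seq // subSS leq_subr.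
Qed.

Lemma ps_inv_unique a b : a 0%N = 1 -> ps_mul a b =1 ps_one -> b =1 ps_inv a.
Proof.
move=> a0 ab; elim/ltn_ind => n IH; have := ab n; rewrite -(ps_mulV a0) /ps_mul.
rewrite !big_ord_recl a0 !mul1r !subn0.
set U := bigop _ _ _; set V := bigop _ _ _; have -> : U = V; last by move/addIr.
apply: eq_bigr => i _; congr (_ * _); apply: IH.
by rewrite /= /bump /= add1n ltn_subrL (leq_ltn_trans _ (ltn_ord i)).
Qed.

End PowerSeries.

Section GeneratingFunctions.
Variable R : comNzRingType.
Notation Lam := (symfun {poly R}).

Definition F2 : nat -> Lam :=
  ps_inv (@ps_one Lam \-
    (fun n => if (2 <= n)%N then ('X * qint R (n - 1)) *: sfh _ n else 0)).

(* The functions [g_k] of the one-vertex graph, each computed on a path with [N k]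
   vertices; [N] is any sequence with [k < N k]. *)
Definition point_g (N : nat -> nat) : nat -> Lam :=
  fun k => hess_g R (path_hess (N k)) k.

End GeneratingFunctions.

(* Main.v *)
(* A permutation of [n] with s(i) <= i + 1 is a product of cycles
   (a, a + 1, ..., b) on consecutive intervals.  Hence s^c is the identity, all the
   weights vanish, and s corresponds to the composition of n formed by its cycle
   lengths.  Writing W = 1 / (1 - sum_(i >= 1) omega(rho_i) z^i) for the sum over
   compositions, this gives sum_k g_k z^k = H(-z) W(z) = W(z) / E(z).  Applying
   omega to the recursion of rho gives E(z) sum_(i >= 1) omega(rho_i) z^i =
   sum_(i >= 1) [i]_q e_i z^i, so that E / W = 1 - q sum_(k >= 2) [k-1]_q e_k z^k
   because [i]_q - 1 = q [i-1]_q. *)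

Require Import Defs.
From HB Require Import structures.
From mathcomp Require Import all_boot all_order all_algebra all_fingroup.
From mathcomp Require Import boolp.
From mathcomp Require Import ssrcomplements freeg mpoly.

Set Implicit Arguments.
Unset Strict Implicit.
Unset Printing Implicit Defensive.

Import GRing.Theory.

Local Open Scope ring_scope.

(** * Permutations whose cycles run through consecutive intervals *)

Section RunCycles.
Variable n : nat.
Implicit Types (s t : 'S_n) (c : seq 'I_n) (cs : seq (seq 'I_n)).


Lemma block_iota cs c : flatten cs = enum 'I_n -> c \in cs ->
  exists a, map val c = iota a (size c).
Proof.
move=> fcs ccs; case/splitPr: ccs fcs => cs1 cs2 /(congr1 (map val)).
rewrite val_enum_ord flatten_cat /= !map_cat => e.
have := congr1 size e; rewrite size_iota !size_cat => en; move: e.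
rewrite -[X in iota _ X]en !iotaD !add0n => /eqP.
rewrite !eqseq_cat ?size_iota // => /and3P[_ /eqP e _].
by exists (size (map val (flatten cs1))); rewrite e [size (map _ c)]size_map.
Qed.

Lemma uniq_block cs c : flatten cs = enum 'I_n -> c \in cs -> uniq c.
Proof.
move=> fcs ccs; have [a e] := block_iota fcs ccs.
by rewrite -(map_inj_uniq val_inj) e iota_uniq.
Qed.

Lemma next_run c a x : map val c = iota a (size c) -> x \in c ->
  val (next c x) = if (x.+1 < a + size c)%N then x.+1 else a.
Proof.
move=> e xc; have ix : (index x c < size c)%N by rewrite index_mem.
have xE : (x : nat) = (a + index x c)%N.
  by rewrite -{1}(nth_index x xc) -(nth_map x (val x)) // e nth_iota.
rewrite next_nth xc; case: c => // y p in e xc ix xE *.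
rewrite [in X in if X then _ else _]xE -addnS ltn_add2l ltnS; case: e => ya e.
(* Past the end, [nth] returns its default [y], the head of the run: this is the wrap-around to
   [a]. *)
case: ltnP => h; last by rewrite nth_default.
by rewrite -(nth_map y (val y) val) // e nth_iota // addSn xE.
Qed.

(** A certificate that [s] is the product of cycles on the intervals [cs]. Empty blocks are excluded
    because [cycle_decomp] never lists one. *)
Definition run_cycles s cs :=
  [/\ flatten cs = enum 'I_n, [::] \notin cs & {in cs, forall c, fcycle s c}].

(** The orbit of any element of a block is a rotation of that block. Only the head of the block is
    least in its orbit, so each block passes the filter exactly once, and unrotated. *)
Lemma cycle_decomp_run s cs : run_cycles s cs -> cycle_decomp s = cs.
Proof.
case=> fcs ncs ccs; rewrite /cycle_decomp -fcs filter_flatten map_flatten -map_comp.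
rewrite -[RHS]flatten_seq1; congr flatten; apply/eq_in_map => c ic /=.
have uc := uniq_block fcs ic; have [a ea] := block_iota fcs ic.
have oc x : x \in c -> fingraph.orbit s x = rot (index x c) c.
  move=> xc; exact (fingraph.orbitE (ccs c ic) uc xc).
case: c ic uc ea oc => [|x p] ic uc ea oc; first by rewrite ic in ncs.
have xp y : y \in p -> (x < y)%N.
  case: ea => -> ea yp; have : val y \in map val p by rewrite map_f.
  by rewrite ea mem_iota => /andP[].
rewrite /= ifT.
  rewrite [filter _ p](_ : _ = [::]).
    by rewrite /= oc ?mem_head // index_head rot0.
  rewrite -(filter_pred0 p); apply: eq_in_filter => y yp.
  apply/negP => /forall_inP/(_ x).
  by rewrite oc ?inE ?yp ?orbT // mem_rot mem_head leqNgt xp // => /(_ isT).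
apply/forall_inP => y; rewrite oc ?mem_head // mem_rot inE => /predU1P[->//|/xp].
exact: ltnW.
Qed.

Lemma run_cycles_inj s t cs : run_cycles s cs -> run_cycles t cs -> s = t.
Proof.
case=> fcs _ sc [_ _ tc]; apply/permP => x.
have : x \in flatten cs by rewrite fcs mem_enum.
case/flattenP => c ic xc.
by rewrite (eqP (next_cycle (sc c ic) xc)) (eqP (next_cycle (tc c ic) xc)).
Qed.

Lemma path_hess_permP s :
  reflect (forall i, (s i <= i.+1)%N) (s \in hess_perms (path_hess n)).
Proof.
rewrite inE; apply: (iffP forallP) => H i; have := H i.
  by rewrite /= leq_min => /andP[].
by rewrite /= leq_min => ->; have := ltn_ord (s i); case: n (s i).
Qed.

Lemma run_cycles_hess s cs : run_cycles s cs -> s \in hess_perms (path_hess n).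
Proof.
case=> fcs _ sc; apply/path_hess_permP => x.
have : x \in flatten cs by rewrite fcs mem_enum.
case/flattenP => c ic xc; have [a ea] := block_iota fcs ic.
rewrite (eqP (next_cycle (sc c ic) xc)) [X in (X <= _)%N](next_run ea xc).
case: ifP => // _; have : val x \in map val c by rewrite map_f.
by rewrite ea mem_iota => /andP[/leqW].
Qed.

(** The witness sends [x] to its cyclic successor in the block [B x] containing it; the cyclic
    predecessor is its inverse. *)
Lemma run_cycles_exists cs : flatten cs = enum 'I_n -> [::] \notin cs ->
  exists s, run_cycles s cs.
Proof.
move=> fcs ncs; pose B x := nth [::] cs (find (fun c => x \in c) cs).
have hB x : has (fun c => x \in c) cs.
  have : x \in flatten cs by rewrite fcs mem_enum.
  by case/flattenP => c ic xc; apply/hasP; exists c.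
have xB x : x \in B x by exact: (nth_find [::] (hB x)).
have iB x : B x \in cs by rewrite mem_nth // -has_find.
have uB x : uniq (B x) by exact: uniq_block fcs (iB x).
(* Two distinct blocks through [x] would make [x] occur twice in [flatten cs]. *)
have BE c x : c \in cs -> x \in c -> B x = c.
  move=> ic xc.
  have : uniq (flatten cs) by rewrite fcs enum_uniq.
  move: (iB x) (xB x); move: (B x) => d id xd.
  case/splitPr: ic id => cs1 cs2; rewrite mem_cat inE flatten_cat /= !cat_uniq.
  rewrite has_cat negb_or => /or3P[d1|/eqP//|d2] /and3P[_ /andP[/hasPn h1 _]].
    by case/negP: (h1 x xc); change (x \in flatten cs1); apply/flattenP; exists d.
  case/and3P=> _ /hasPn h2 _.
  have xcs2 : x \in flatten cs2 by apply/flattenP; exists d.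
  by case/negP: (h2 x xcs2).
have fK : cancel (fun x => next (B x) x) (fun x => prev (B x) x).
  by move=> x /=; rewrite (BE (B x)) ?mem_next // prev_next.
exists (perm (can_inj fK)); split=> // c ic.
have uc : uniq c by exact: uniq_block fcs ic.
by apply: cycle_from_next => // x xc; rewrite /= permE (BE c).
Qed.

Lemma hess_run_cycles s : s \in hess_perms (path_hess n) ->
  exists cs, run_cycles s cs.
Proof.
move/path_hess_permP => hs.
(* Cycles are peeled off from the left. The invariant says that [s] preserves the set of indices at
   least [k], on which it remains to be decomposed. *)
suff main k : (k <= n)%N -> (forall j : 'I_n, (k <= s j)%N = (k <= j)%N) ->
    exists cs, [/\ flatten cs = drop k (enum 'I_n), [::] \notin cs &
      {in cs, forall c, fcycle s c}].
  by have [//|cs] := main 0%N (leq0n _); rewrite drop0; exists cs.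
have [m] := ubnP (n - k); elim: m k => // m IH k; rewrite ltnS => km.
rewrite leq_eqVlt => /predU1P[->|kn] hk.
  by exists [::]; split=> //; rewrite drop_oversize // size_enum_ord.
(* With [s b = k], injectivity leaves [i.+1] as the only possible value at each
   [i] with [k <= i < b], so [k, ..., b] is a cycle. *)
pose b := s^-1%g (Ordinal kn).
have sb : val (s b) = k by rewrite permKV.
have kb : (k <= b)%N by rewrite -hk sb.
pose run i := forall j : 'I_n, (k <= j < i)%N -> val (s j) = j.+1.
(* The value [k] is taken by [b], and the values k+1, ..., i by the indices k, ..., i-1, so [s j]
   must exceed [i]. *)
have beyond i (j : 'I_n) : run i -> (i <= j)%N -> (k <= j)%N -> j != b -> (i < s j)%N.
  move=> ri ij kj jb; rewrite ltnNge; apply/negP => sji.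
  have := kj; rewrite -hk; rewrite leq_eqVlt => /predU1P[e|ks].
    by case/eqP: jb; apply: (@perm_inj _ s); apply: val_inj; rewrite sb.
  have p0 := leq_ltn_trans (leq0n _) ks.
  have pn : ((s j).-1 < n)%N by apply: leq_ltn_trans (ltn_ord (s j)); exact: leq_pred.
  have /perm_inj e : s (Ordinal pn) = s j.
    apply: val_inj; rewrite ri /= ?prednK // -ltnS prednK //.
    by rewrite ks.
  by move: ij; rewrite -e /= leqNgt prednK ?sji.
have runb i : (i <= b)%N -> run i.
  elim: i => [|i IHi] ib; first by move=> j; rewrite ltn0 andbF.
  move=> j /andP[kj]; rewrite ltnS leq_eqVlt => /predU1P[ji|ji]; last first.
    by apply: IHi; rewrite ?kj // ltnW.
  apply/eqP; rewrite eqn_leq hs ji beyond //; first exact/IHi/ltnW.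
  - by rewrite -ji.
  - by apply/eqP => jb; move: ib; rewrite -jb ji ltnn.
have {}runb := runb _ (leqnn b).
have [||cs [fcs ncs ccs]] := IH b.+1 _ (ltn_ord b).
- by apply: leq_trans km; rewrite ltn_sub2l // ltnS.
- move=> j; case: (ltngtP b j) => [bj|jb|/val_inj <-]; last first.
  + by rewrite sb ltnNge kb.
  + case: (leqP k j) => kj; first by rewrite runb ?kj // ltnNge jb.
    apply/negbTE; rewrite -leqNgt; apply: leq_trans kb.
    by rewrite ltnW // ltnNge hk -ltnNge.
  + apply: beyond => //; [exact: ltnW|exact: leq_trans kb (ltnW bj)|].
    by apply: contraTneq bj => ->; rewrite ltnn.
pose c := take (b.+1 - k) (drop k (enum 'I_n)).
have sc : size c = (b.+1 - k)%N.
  by rewrite size_takel // size_drop size_enum_ord leq_sub2r.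
have ec : map val c = iota k (size c).
  rewrite sc map_take map_drop val_enum_ord drop_iota take_iota add0n.
  by congr iota; apply/minn_idPl; rewrite leq_sub2r.
have kbS : (k + size c = b.+1)%N by rewrite sc subnKC // leqW.
exists (c :: cs); split.
- rewrite /= fcs -[in RHS](cat_take_drop (b.+1 - k) (drop k (enum 'I_n))).
  by rewrite drop_drop subnK // leqW.
- rewrite inE negb_or ncs andbT eq_sym -size_eq0 sc subn_eq0 -ltnNge ltnS //.
move=> d; rewrite inE => /predU1P[->|]; last exact: ccs.
have uc : uniq c by rewrite -(map_inj_uniq val_inj) ec iota_uniq.
apply: cycle_from_next => // x xc; apply/eqP/val_inj.
have : val x \in map val c by rewrite map_f.
rewrite (next_run ec xc) ec mem_iota kbS !ltnS => /andP[kx].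
rewrite leq_eqVlt => /predU1P[xb|xb].
  by rewrite xb ltnn -sb; congr (val (s _)); apply: val_inj.
by rewrite xb runb // kx.
Qed.

End RunCycles.

(** * Weights and cycle shapes on the path *)

Lemma erase_parens_run n (s : 'S_n) :
  flatten (cycle_decomp s) = enum 'I_n -> erase_parens s = 1%g.
Proof. by move=> e; apply/permP => i; rewrite permE e nth_ord_enum perm1. Qed.

Lemma hess_wt_path n (s : 'S_n) :
  s \in hess_perms (path_hess n) -> hess_wt (path_hess n) s = 0%N.
Proof.
move=> /hess_run_cycles[cs rs].
have e : flatten (cycle_decomp s) = enum 'I_n.
  by rewrite (cycle_decomp_run rs); case: rs.
apply/eqP; rewrite cards_eq0; apply/eqP/setP => -[i j].
rewrite !inE erase_parens_run // invg1 !perm1 /=.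
by case: ltngtP; rewrite ?andbF.
Qed.

(** The two branches separate a first part equal to 1 from a larger one. The filter discards
    something only at [n' = 0], where the empty composition has no first part to enlarge. *)
Fixpoint compositions n : seq (seq nat) :=
  if n is n'.+1 then
    [seq 1%N :: c | c <- compositions n'] ++
    [seq (head 0%N c).+1 :: behead c | c <- compositions n' & c != [::]]
  else [:: [::]].

Lemma mem_compositions n c :
  (c \in compositions n) = (sumn c == n) && (0%N \notin c).
Proof.
elim: n c => [|n IH] c /=.
  by rewrite inE; case: c => // -[|i] c /=; rewrite ?inE ?eqxx ?andbF.
rewrite mem_cat; apply/orP/andP => [[/mapP[d]|/mapP[d]]|[]].
- by rewrite IH => /andP[/eqP <- d0] ->; rewrite inE.
- rewrite mem_filter IH; case: d => // i d /= /andP[/eqP <- d0] ->.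
  by move: d0; rewrite !inE !negb_or => /andP[_ ->].
case: c => // -[|[|i]] c; rewrite /= ?inE // => /eqP [e] c0.
  by left; apply: map_f; rewrite IH -e eqxx.
right; apply/mapP; exists (i.+1 :: c) => //.
by rewrite mem_filter IH /= -e eqxx inE c0.
Qed.

Lemma uniq_compositions n : uniq (compositions n).
Proof.
elim: n => //= n IH; rewrite cat_uniq map_inj_in_uniq ?IH /=; last by move=> ? ? ? ? [].
rewrite map_inj_in_uniq ?filter_uniq // ?andbT; last first.
  by move=> [|i c] [|j d]; rewrite ?mem_filter //= => _ _ [-> ->].
apply/hasPn => _ /mapP[c + ->]; rewrite mem_filter mem_compositions.
case: c => [//|[|i] c] /=; first by rewrite ?inE ?andbF.
by move=> _; apply/mapP => -[].
Qed.

(** The list of cycle lengths is a bijective encoding: since the cycles concatenate to [enum 'I_n],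
    their lengths determine them, and they determine the permutation. *)
Lemma perm_shapes n :
  perm_eq [seq shape (cycle_decomp s) | s : 'S_n in hess_perms (path_hess n)]
    (compositions n).
Proof.
apply: uniq_perm; first 1 last.
- exact: uniq_compositions.
- move=> c; rewrite mem_compositions; apply/imageP/andP => [[s hs ->]|[/eqP cn c0]].
    have [cs rs] := hess_run_cycles hs; rewrite (cycle_decomp_run rs).
    case: rs => fcs ncs _; rewrite -size_flatten fcs size_enum_ord eqxx; split=> //.
    by apply: contra ncs => /mapP[d ds /esym/size0nil <-].
  have sn : size (enum 'I_n) = sumn c by rewrite size_enum_ord.
  (* Conversely, cutting [enum 'I_n] into blocks of lengths [c] gives the cycles of a preimage. *)
  have [||s rs] := @run_cycles_exists n (reshape c (enum 'I_n)).
  + by rewrite reshapeKr ?sn.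
  + apply: contra c0 => /(map_f size); rewrite -/(shape _).
    by rewrite reshapeKl ?sn.
  + exists s; first exact: run_cycles_hess rs.
    by rewrite (cycle_decomp_run rs) reshapeKl ?sn.
- rewrite map_inj_in_uniq ?enum_uniq // => s t; rewrite !mem_enum.
  move=> /hess_run_cycles[cs rs] /hess_run_cycles[ds rt].
  rewrite (cycle_decomp_run rs) (cycle_decomp_run rt) => e.
  have f : cs = ds.
    by apply: eq_from_flatten_shape => //; case: rs => -> _ _; case: rt => ->.
  by apply: (run_cycles_inj rs); rewrite f.
Qed.

(** * Formal power series and sums over compositions *)

Section PowerSeriesTheory.
Variable A : comNzRingType.
Implicit Types a b : nat -> A.

(** A coefficient of a product depends only on truncations of the factors, so commutativity and
    associativity can be transferred from polynomials. *)
Lemma ps_mulE n m a b : (n < m)%N ->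
  ps_mul a b n = ((\poly_(i < m) a i) * (\poly_(i < m) b i))`_n.
Proof.
move=> nm; rewrite coefM; apply: eq_bigr => i _.
by rewrite !coef_poly !ifT // (leq_ltn_trans _ nm) ?leq_subr // -ltnS.
Qed.

Lemma ps_mulC a b : ps_mul a b =1 ps_mul b a.
Proof. by move=> n; rewrite !(ps_mulE _ _ (ltnSn n)) mulrC. Qed.

Lemma eq_ps_mul a a' b b' : a =1 a' -> b =1 b' -> ps_mul a b =1 ps_mul a' b'.
Proof. by move=> aa bb n; apply: eq_bigr => i _; rewrite aa bb. Qed.

Lemma ps_mulA a b (c : nat -> A) : ps_mul a (ps_mul b c) =1 ps_mul (ps_mul a b) c.
Proof.
move=> n.
have T (x : nat -> A) i : (i <= n)%N -> x i = (\poly_(j < n.+1) x j)`_i.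
  by rewrite coef_poly ltnS => ->.
transitivity (((\poly_(i < n.+1) a i) *
   ((\poly_(i < n.+1) b i) * (\poly_(i < n.+1) c i)))`_n).
  rewrite coefM; apply: eq_bigr => i _.
  by rewrite (@ps_mulE _ n.+1) ?ltnS ?leq_subr // -T // -ltnS.
rewrite mulrA coefM; apply: eq_bigr => i _.
by rewrite -T ?leq_subr // (@ps_mulE _ n.+1).
Qed.

Lemma ps_mul1 a : ps_mul (@ps_one A) a =1 a.
Proof.
move=> n; rewrite /ps_mul big_ord_recl mul1r subn0 big1 ?addr0 // => i _.
by rewrite /ps_one mul0r.
Qed.

Definition composition_sum (w : nat -> A) n :=
  \sum_(c <- compositions n) \prod_(i <- c) w i.

(** Classification by the first part. The induction needs [f] arbitrary, because enlarging the first
    part by one replaces [f] by [f \o S]. *)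
Lemma sum_compositions_head (w f : nat -> A) n :
  \sum_(c <- compositions n.+1) f (head 0%N c) * \prod_(i <- behead c) w i =
  \sum_(i < n.+1) f i.+1 * composition_sum w (n - i).
Proof.
elim: n f => [|n IH] f.
  by rewrite big_seq1 big_ord1 /composition_sum big_seq1.
rewrite [compositions _]/= -/(compositions n.+1) big_cat !big_map /= big_filter.
rewrite big_ord_recl subn0 -mulr_sumr; congr (_ + _).
rewrite big_seq_cond (eq_bigl (fun c => c \in compositions n.+1)); last first.
  by case=> [|i c]; rewrite ?andbT // mem_compositions.
by rewrite -big_seq (IH (f \o S)).
Qed.

Lemma composition_sum0 w : composition_sum w 0 = 1.
Proof. by rewrite /composition_sum big_seq1 big_nil. Qed.

Lemma composition_sumS w n :
  composition_sum w n.+1 = \sum_(i < n.+1) w i.+1 * composition_sum w (n - i).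
Proof.
rewrite -sum_compositions_head; apply: eq_big_seq => -[|i c].
  by rewrite mem_compositions.
by rewrite big_cons.
Qed.

(** The series of [composition_sum w] is the geometric series 1 / (1 - sum_(i >= 1) w_i z^i). The
    [match] keeps the constant coefficient equal to 1 whatever [w 0] is. *)
Lemma ps_mul_composition_sum w :
  ps_mul (@ps_one A \- (fun n => if n is 0 then 0 else w n)) (composition_sum w)
    =1 @ps_one A.
Proof.
move=> [|n]; rewrite /ps_mul big_ord_recl /= subr0 mul1r ?subn0.
  by rewrite composition_sum0 big_ord0 addr0.
rewrite composition_sumS -big_split big1 //= => i _.
by rewrite sub0r mulNr subSS subrr.
Qed.

Lemma ps_mul_one_subS a (w : nat -> A) n :
  ps_mul a (@ps_one A \- (fun n => if n is 0 then 0 else w n)) n.+1 =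
  a n.+1 - \sum_(i < n.+1) a i * w (n.+1 - i)%N.
Proof.
rewrite /ps_mul big_ord_recr /= subnn subr0 mulr1 addrC -sumrN; congr (_ + _).
by apply: eq_bigr => i _; rewrite subSn ?leq_ord // sub0r mulrN.
Qed.

End PowerSeriesTheory.

(** * The generating function of the one-vertex graph *)

Section PointFunction.
Variable R : comNzRingType.
Notation Lam := (symfun {poly R}).
Notation w := (fun i => omega {poly R} (rho R i)).

(** A first cycle of length n - k + a contributes (-1)^a h_a, and the other cycles form a
    composition of k - a; summing over a gives a convolution independent of [n]. *)
Lemma hess_g_path n k : (k < n)%N ->
  hess_g R (path_hess n) k =
  ps_mul (fun a => (-1) ^+ a *: sfh {poly R} a) (composition_sum w) k.
Proof.
(* [f] is the factor of a first cycle of length [i]; it is 0 below the threshold, which absorbs the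
   condition on the summation. *)
move=> kn; pose f i : Lam :=
  if (n - k <= i)%N then (-1) ^+ (i - (n - k)) *: sfh {poly R} (i - (n - k)) else 0.
transitivity (\sum_(c <- compositions n) f (head 0%N c) * \prod_(i <- behead c) w i).
  rewrite /hess_g big_mkcondr /= -(perm_big _ (perm_shapes n)) big_map big_enum /=.
  apply: eq_bigr => s hs; rewrite hess_wt_path // expr0 mulr1 rmorph_prod /f.
  case: (cycle_decomp s) => [|c cs] /=; case: ifP; rewrite ?mul0r // => _.
    by rewrite scalerAl !big_nil.
  by rewrite scalerAl big_map.
case: n kn @f => [//|n]; rewrite ltnS => kn f.
have fE i : f (n - k + i).+1 = (-1) ^+ i *: sfh {poly R} i.
  by rewrite /f subSn // ltnS leq_addr subSS addKn.
rewrite sum_compositions_head.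
rewrite -(big_mkord xpredT (fun i => f i.+1 * composition_sum w (n - i))).
(* There are now [n.+1] vertices and the first part is [i.+1], so the terms with [i < n - k] are
   exactly those below the threshold. *)
rewrite (@big_cat_nat _ _ _ (n - k)) ?leqW ?leq_subr //=.
rewrite big_nat_cond big1 ?add0r => [|i]; last first.
  by rewrite andbT => /andP[_ ik]; rewrite /f subSn // ltnS leqNgt ik mul0r.
rewrite -{1}[(n - k)%N]add0n big_addn subSn ?leq_subr // subKn // big_mkord.
apply: eq_bigr => i _; rewrite addnC fE; congr (_ * composition_sum _ _).
by rewrite subnDA subKn.
Qed.

Lemma omega_rhoE n :
  qint R n.+1 *: sfe {poly R} n.+1 = \sum_(i < n.+1) sfe _ i * w (n.+1 - i)%N.
Proof.
rewrite -omega_h -linearZ rhoE // big_mkord (raddf_sum (omega {poly R})). 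
by apply: eq_bigr => i _; rewrite -omega_h -(rmorphM (omega {poly R})).
Qed.

Lemma point_denominatorE :
  (@ps_one Lam \-
      'X \*: (fun k => if (2 <= k)%N then qint R (k - 1) *: sfe _ k else 0)) =1
  ps_mul (sfe {poly R}) (@ps_one Lam \- (fun n => if n is 0 then 0 else w n)).
Proof.
case=> [|n]; first by rewrite /ps_mul big_ord1 sfe0 mul1r /= scaler0.
(* By [n+1]_q = 1 + q [n]_q, the summand 1 cancels the leading e_(n+1). *)
rewrite ps_mul_one_subS -omega_rhoE /qint big_ord_recl expr0 scalerDl scale1r.
rewrite opprD addrA subrr add0r /ps_one /= sub0r.
(* The coefficient of z is 0 on both sides: [0]_q = 0 agrees with the cutoff [2 <= k]. *)
congr (- _); rewrite subn1 /=; case: n => [|n].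
  by rewrite scaler0 big_ord0 scale0r.
rewrite scalerA mulr_sumr; congr (_ *: _).
by apply: eq_bigr => i _; rewrite exprS.
Qed.

(** This is E(z) H(-z) = 1. *)
Lemma ps_mul_sfe_sfh :
  ps_mul (sfe {poly R}) (fun a => (-1) ^+ a *: sfh {poly R} a) =1 @ps_one Lam.
Proof.
move=> n; rewrite ps_mulC; case: n => [|n].
  by rewrite /ps_mul big_ord1 sfe0 sfh0 scale1r mulr1.
rewrite /ps_mul -[RHS](sum_sfh_sfe {poly R} (ltn0Sn n)).
by apply: eq_bigr => i _; rewrite scalerAl.
Qed.

End PointFunction.

Theorem corollary3p11 (R : comNzRingType) (N : nat -> nat)
    (HN : forall k : nat, (k < N k)%N) :
  let D : nat -> symfun {poly R} :=
    ps_inv (@ps_one (symfun {poly R}) \-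
      'X \*: (fun k => if (2 <= k)%N then qint R (k - 1) *: sfe _ k else 0)) in
  point_g R N =1 D /\ D =1 omega {poly R} \o F2 R.
Proof.
move=> D; split; last first.
  move=> n; apply/esym; move: n; apply: ps_inv_unique => [|n].
    by rewrite /= scaler0 subr0.
  set h := (@ps_one (symfun {poly R}) \-
    (fun n => if (2 <= n)%N then ('X * qint R (n - 1)) *: sfh _ n else 0)).
  (* Being a ring morphism, [omega] commutes with the convolution; it carries the denominator [h] of
     [F2] to that of [D], since it maps h_n to e_n. *)
  transitivity (omega _ (ps_mul h (F2 R) n)).
    rewrite raddf_sum; apply: eq_bigr => i _ /=.
    rewrite rmorphM /= /h /= rmorphB /=; congr ((_ - _) * _).
      by rewrite /ps_one rmorph_nat.
    case: ifP => _; last by rewrite !raddf0.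
    by rewrite scalerA -omega_h -linearZ.
  rewrite /F2 -/h ps_mulV; last by rewrite /h /= subr0.
  by rewrite /ps_one rmorph_nat.
move=> k; rewrite /point_g hess_g_path //; move: k.
apply: ps_inv_unique => [|n]; first by rewrite /= scaler0 subr0.
(* With P the series of the omega(rho_i), the product (E (1 - P)) (H(-z) W) is regrouped as (E
   H(-z)) ((1 - P) W), and both factors are 1. *)
rewrite (eq_ps_mul (@point_denominatorE R) (frefl _)).
rewrite -ps_mulA (eq_ps_mul (frefl _) (ps_mulA _ _ _)).
rewrite (eq_ps_mul (frefl _) (eq_ps_mul (ps_mulC _ _) (frefl _))).
rewrite (eq_ps_mul (frefl _) (fsym (ps_mulA _ _ _))) ps_mulA.
rewrite (eq_ps_mul (@ps_mul_sfe_sfh R) (@ps_mul_composition_sum _ _)).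
by rewrite ps_mul1.
Qed.
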